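(* Let $A$ be a positive information algebra, let $L$ be a join-semilattice disjoint from $A$, and let $S=A\uplus_{\mathrm{ord}}L$ be the overflow semiring. For a semiring $R$ let $\operatorname{VNR}^+(R)$ be the set of $x\in R$ for which there is $y\in R$ with $x+y+x=x$, and let $\operatorname{VNR}^\times(R)$ be the set of $x\in R$ for which there is $y\in R$ with $x\cdot y\cdot x=x$. Then \[ \operatorname{VNR}^+(S)=\operatorname{VNR}^+(A)\cup L,\qquad \operatorname{VNR}^\times(S)=\operatorname{VNR}^\times(A)\cup L. \]
   Context: All semirings are commutative: $(S,+,0)$ and $(S,\cdot,1)$ are commutative monoids, $1\neq 0$, multiplication distributes over addition, and $0$ is absorbing. A semiring is zerosumfree if $a+b=0$ implies $a=b=0$, and entire if $ab=0$ implies $a=0$ or $b=0$; an information algebra is a zerosumfree entire semiring. A positive information algebra is an information algebra with a partial order $\leq$ compatible with $+$ and $\cdot$ (i.e. $x\leq y$ implies $x+z\leq y+z$ and $xz\leq yz$) and having $0$ as least element. Overflow semiring $S=A\uplus_{\mathrm{ord}}L$: for a positive information algebra $A$ and a join-semilattice $L$ disjoint from $A$, $S=A\cup L$ with the order extending those of $A$ and $L$ by $a\leq\ell$ for all $a\in A,\ell\in L$ (and never $\ell\leq a$), and operations: $x+y=x+_Ay$ if $x,y\in A$, $x+y=\sup\{x,y\}$ otherwise; $xy=x\cdot_Ay$ if $x,y\in A\setminus\{0\}$, $xy=0$ if $x=0$ or $y=0$, and $xy=\sup\{x,y\}$ otherwise. With these, $S$ is a positive information algebra. *)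

(* Defs.v *)
From HB Require Import structures.
From mathcomp Require Import all_boot all_order ssralg.

Set Implicit Arguments.
Unset Strict Implicit.
Unset Printing Implicit Defensive.

Import Order.Theory GRing.Theory.
Local Open Scope ring_scope.

Definition zerosumfree (R : comNzSemiRingType) : Prop :=
  forall a b : R, a + b = 0 -> a = 0 /\ b = 0.

Definition entire (R : comNzSemiRingType) : Prop :=
  forall a b : R, a * b = 0 -> a = 0 \/ b = 0.

HB.mixin Record ComNzSemiRing_isInfoAlgebra R of GRing.ComNzSemiRing R := {
  info_zerosumfree : zerosumfree R;
  info_entire : entire R
}.

#[short(type="infoAlgebraType")]
HB.structure Definition InfoAlgebra :=
  {R of ComNzSemiRing_isInfoAlgebra R & GRing.ComNzSemiRing R}.

HB.mixin Record InfoAlgebra_isPositive (d : Order.disp_t) R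
    of InfoAlgebra R & Order.POrder d R := {
  pinfo_leD : forall x y z : R, (x <= y)%O -> (x + z <= y + z)%O;
  pinfo_leM : forall x y z : R, (x <= y)%O -> (x * z <= y * z)%O;
  pinfo_ge0 : forall x : R, ((0 : R) <= x)%O
}.

#[short(type="posInfoAlgebraType")]
HB.structure Definition PosInfoAlgebra (d : Order.disp_t) :=
  {R of InfoAlgebra_isPositive d R & InfoAlgebra R & Order.POrder d R}.

(* The carrier of the overflow semiring; the tagged sum makes A and L
   disjoint.  Its order carries the display of A. *)
Definition overflow (d d' : Order.disp_t) (A : posInfoAlgebraType d)
  (L : joinSemilatticeType d') : Type := (A + L)%type.

Section Overflow.
Variables (d d' : Order.disp_t).
Variables (A : posInfoAlgebraType d) (L : joinSemilatticeType d').
Local Notation S := (overflow A L).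

Definition ofA (a : A) : S := inl a.
Definition ofL (l : L) : S := inr l.

Definition overflow_le (x y : S) : bool :=
  match x, y with
  | inl a, inl b => (a <= b)%O
  | inl _, inr _ => true
  | inr _, inl _ => false
  | inr l, inr m => (l <= m)%O
  end.

(* As L lies above A, the supremum of a mixed pair is its element in L;
   see [overflow_add_sup] and [overflow_mul_sup] below. *)
Definition overflow_add (x y : S) : S :=
  match x, y with
  | inl a, inl b => ofA (a + b)
  | inl _, inr m => ofL m
  | inr l, inl _ => ofL l
  | inr l, inr m => ofL (l `|` m)%O
  end.

Definition overflow_mul (x y : S) : S :=
  match x, y with
  | inl a, inl b => ofA (a * b)
  | inl a, inr m => if a == 0 then ofA 0 else ofL m
  | inr l, inl b => if b == 0 then ofA 0 else ofL l
  | inr l, inr m => ofL (l `|` m)%O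
  end.

HB.instance Definition _ := Choice.copy S (A + L)%type.

Fact overflow_le_refl : reflexive overflow_le.
Proof. by case=> x /=. Qed.

Fact overflow_le_anti : antisymmetric overflow_le.
Proof. by case=> [a|l] [b|m] //= /le_anti ->. Qed.

Fact overflow_le_trans : transitive overflow_le.
Proof. by case=> [a|l] [b|m] [c|n] //=; apply: le_trans. Qed.

HB.instance Definition _ := Order.Le_isPOrder.Build d S
  overflow_le_refl overflow_le_anti overflow_le_trans.

Fact overflow_addA : associative overflow_add.
Proof. by case=> [a|l] [b|m] [c|n] //=; rewrite ?addrA ?joinA. Qed.

Fact overflow_addC : commutative overflow_add.
Proof. by case=> [a|l] [b|m] //=; rewrite 1?addrC 1?joinC. Qed.

Fact overflow_add0 : left_id (ofA 0) overflow_add.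
Proof. by case=> [a|l] //=; rewrite add0r. Qed.

HB.instance Definition _ := GRing.isNmodule.Build S
  overflow_addA overflow_addC overflow_add0.

Fact info_addf_eq0 (a b : A) : (a + b == 0) = (a == 0) && (b == 0).
Proof.
apply/eqP/andP => [/info_zerosumfree[-> ->]|[/eqP-> /eqP->]]; first by [].
by rewrite addr0.
Qed.

Fact info_mulf_eq0 (a b : A) : (a * b == 0) = (a == 0) || (b == 0).
Proof.
apply/eqP/orP => [/info_entire[]->|[]/eqP->]; rewrite ?eqxx ?mul0r ?mulr0 //.
- by left.
- by right.
Qed.

Fact overflow_mulC : commutative overflow_mul.
Proof. by case=> [a|l] [b|m] //=; rewrite 1?mulrC 1?joinC. Qed.

Fact overflow_mulA : associative overflow_mul.
Proof.
case=> [a|l] [b|m] [c|n] /=; rewrite ?mulrA ?joinA //.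
- by rewrite info_mulf_eq0; case: (b == 0); case: (a == 0);
    rewrite /= ?mulr0.
- by case: (eqVneq a 0) => [->|/negPf a0]; case: (eqVneq c 0) => [->|/negPf c0];
    rewrite /= ?mul0r ?mulr0 ?eqxx ?a0 ?c0.
- by case: eqVneq => //=; rewrite eqxx.
- by rewrite info_mulf_eq0; case: (b == 0); rewrite /= ?mul0r.
- by case: (b == 0); rewrite //= ?eqxx.
- by case: (c == 0); rewrite /= ?eqxx.
Qed.

Fact overflow_mul1 : left_id (ofA 1) overflow_mul.
Proof. by case=> [a|l] /=; rewrite ?mul1r ?oner_eq0. Qed.

Fact overflow_mul0 : left_zero (ofA 0) overflow_mul.
Proof. by case=> [a|l] /=; rewrite ?mul0r ?eqxx. Qed.

Fact overflow_mulDl : left_distributive overflow_mul overflow_add.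
Proof.
case=> [a|l] [b|m] [c|n] /=; rewrite ?mulrDl ?info_addf_eq0 //.
- by case: (a == 0); case: (b == 0); rewrite /= ?addr0 ?joinxx.
- by case: eqVneq => [->|_]; rewrite /= ?mulr0 ?addr0.
- by case: (a == 0); rewrite //= joinCA joinxx.
- by case: eqVneq => [->|_]; rewrite /= ?mulr0 ?addr0.
- by case: (b == 0); rewrite //= -joinA joinxx.
- by case: (c == 0); rewrite /= ?addr0.
- by rewrite joinACA joinxx.
Qed.

Fact overflow_1neq0 : ofA 1 != ofA 0 :> S.
Proof. by apply/eqP => -[] /eqP; rewrite oner_eq0. Qed.

HB.instance Definition _ := GRing.Nmodule_isComNzSemiRing.Build S
  overflow_mulA overflow_mulC overflow_mul1 overflow_mulDl overflow_mul0
  overflow_1neq0.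

Fact overflow_zerosumfree : zerosumfree S.
Proof.
by case=> [a|l] [b|m] // [] /info_zerosumfree[-> ->].
Qed.

Fact overflow_entire : entire S.
Proof.
case=> [a|l] [b|m] //=.
- by case=> /info_entire[] ->; [left | right].
- rewrite /GRing.mul /=; case: eqVneq => [-> _|//]; by left.
- rewrite /GRing.mul /=; case: eqVneq => [-> _|//]; by right.
Qed.

HB.instance Definition _ := ComNzSemiRing_isInfoAlgebra.Build S
  overflow_zerosumfree overflow_entire.

Fact overflow_leD (x y z : S) : (x <= y)%O -> (x + z <= y + z)%O.
Proof.
case: x y z => [a|l] [b|m] [c|n] //=; rewrite /GRing.add /Order.le //=.
- exact: pinfo_leD.
- by move=> _; exact: leUr.
- by move=> le_lm; exact: leU2.
Qed.

Fact overflow_leM (x y z : S) : (x <= y)%O -> (x * z <= y * z)%O.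
Proof.
case: x y z => [a|l] [b|m] [c|n] //=; rewrite /GRing.mul /Order.le //=.
- exact: pinfo_leM.
- case: (eqVneq b 0) => [->|_]; last first.
    by case: (a == 0) => //= _; exact: lexx.
  move=> a_le0; have /eqP -> : a == 0 by rewrite eq_le a_le0 pinfo_ge0.
  by rewrite eqxx /=; exact: lexx.
- by move=> _; case: eqVneq => [->|_] //=; rewrite mulr0; exact: lexx.
- by move=> _; case: (a == 0) => //=; exact: leUr.
- by case: (c == 0) => //= _; exact: lexx.
- by move=> le_lm; exact: leU2.
Qed.

Fact overflow_ge0 (x : S) : ((0 : S) <= x)%O.
Proof. by case: x => [a|l] //; exact: pinfo_ge0. Qed.

HB.instance Definition _ := InfoAlgebra_isPositive.Build d S
  overflow_leD overflow_leM overflow_ge0.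

Definition is_supremum (x y s : S) : Prop :=
  [/\ (x <= s)%O, (y <= s)%O &
      forall z : S, (x <= z)%O -> (y <= z)%O -> (s <= z)%O].

Definition in_A (x : S) : bool := if x is inl _ then true else false.

Lemma overflow_add_sup (x y : S) :
  ~~ (in_A x && in_A y) -> is_supremum x y (x + y).
Proof.
case: x y => [a|l] [b|m] //= _; split; rewrite /GRing.add /Order.le //=.
- exact: leUl.
- exact: leUr.
- by case=> // n ln mn; rewrite leUx; apply/andP.
Qed.

Lemma overflow_mul_sup (x y : S) :
  ~~ (in_A x && in_A y) -> x != 0 -> y != 0 -> is_supremum x y (x * y).
Proof.
move=> nA x0 y0; suff -> : x * y = x + y by exact: overflow_add_sup.
case: x y nA x0 y0 => [a|l] [b|m] //= _ x0 y0; rewrite /GRing.mul /=.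
- by rewrite ifN.
- by rewrite ifN.
Qed.

End Overflow.

Arguments ofA {d d' A} L a.
Arguments ofL {d d'} A {L} l.

(* Imported only here: the structures above join semirings with an order of
   arbitrary display, so they must be declared before [Num.POrderedZmodule],
   which this library loads. *)
From mathcomp Require Import classical_sets.
Local Open Scope classical_set_scope.

Definition VNRadd (R : comNzSemiRingType) : set R :=
  [set x | exists y : R, x + y + x = x].

Definition VNRmul (R : comNzSemiRingType) : set R :=
  [set x | exists y : R, x * y * x = x].

Arguments VNRadd R : clear implicits.
Arguments VNRmul R : clear implicits.

(* Main.v *)
Require Import Defs.
From mathcomp Require Import all_boot all_order ssralg classical_sets.

Import Order.Theory GRing.Theory.
Local Open Scope classical_set_scope.

(** Each [l] in [L] is idempotent for both operations, hence its own witness. For [a] in [A], a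
    witness in [L] would push the result into [L], away from [a], so the witness lies in [A]; the
    one exception is the product with [a = 0]. *)

Theorem proposition3p9 (d d' : Order.disp_t) (A : posInfoAlgebraType d)
    (L : joinSemilatticeType d') :
  (VNRadd (overflow A L) = (ofA L @` VNRadd A) `|` range (ofL A)) /\
  (VNRmul (overflow A L) = (ofA L @` VNRmul A) `|` range (ofL A)).
Proof.
split; apply/seteqP; split=> [[a|l]|x].
- by case=> -[b|m] // [aba]; left; exists a => //; exists b.
- by right; exists l.
- case=> [[a [b aba] <-]|[l _ <-]].
    by exists (ofA L b); congr (ofA L _).
  by exists (ofL A l); congr (ofL A _); rewrite !joinxx.
- case=> -[b|m]; first by case=> aba; left; exists a => //; exists b.
  (* Zero absorbs the witness [m] from [L], but is regular in [A] anyway; for [a] nonzero the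
     product is [m], not in [A]. *)
  have [->|a0] := eqVneq a 0%R.
    by left; exists 0%R => //; exists 0%R; rewrite !mul0r.
  by rewrite /GRing.mul /= (negPf a0) /= (negPf a0).
- by right; exists l.
- case=> [[a [b aba] <-]|[l _ <-]].
    by exists (ofA L b); congr (ofA L _).
  by exists (ofL A l); congr (ofL A _); rewrite !joinxx.
Qed.
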